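(* Let $\kappa$ be a measurable cardinal and let $\mathcal{U}$ be a normal ultrafilter on $\kappa$. Then every set $\mathcal{S} \in \Sigma([\kappa]^{<\omega}, \mathcal{P}(\kappa) - \mathcal{U})$ is Ramsey, as witnessed by a set $H \in \mathcal{U}$; that is, there is $H \in \mathcal{U}$ such that either $[H]^\kappa \subseteq \mathcal{S}$ or $[H]^\kappa \cap \mathcal{S} = \emptyset$.
   Context: A normal ultrafilter on $\kappa$ is a nonprincipal ultrafilter on $\kappa$ that is $\kappa$-complete (closed under intersections of fewer than $\kappa$ sets) and closed under diagonal intersections. $[\kappa]^\delta$ is the set of subsets of $\kappa$ of order type $\delta$, $[\kappa]^{<\delta}$ those of order type $<\delta$. A pattern is a pair $(A,B)$ of disjoint subsets of $\kappa$; $X\in[\kappa]^\kappa$ matches $(A,B)$ iff $A\subseteq X$ and $B\cap X=\emptyset$; $[A;B]$ is the set of all $X\in[\kappa]^\kappa$ matching $(A,B)$. $\Sigma(\mathcal{A},\mathcal{B})$ is the collection of all $\mathcal{S}\subseteq[\kappa]^\kappa$ that are unions of sets $[A;B]$ with $(A,B)$ a pattern, $A\in\mathcal{A}$, $B\in\mathcal{B}$. *)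

(* Defs.v *)
From mathcomp Require Import all_boot all_order.
From mathcomp Require Import boolp classical_sets functions cardinality filter.
From mathcomp Require wochoice.

Set Implicit Arguments.
Unset Strict Implicit.
Unset Printing Implicit Defensive.

Local Open Scope order_scope.
Local Open Scope classical_set_scope.
Local Open Scope card_scope.

Definition card_lt (T W : Type) (A : set T) (B : set W) : Prop :=
  A #<= B /\ ~ (B #<= A).

Definition initial_segment (d : Order.disp_t) (W : orderType d) (w : W) :
  set W := [set x | x < w].

Definition order_isomorphic (d d' : Order.disp_t) (T : orderType d)
    (W : orderType d') (A : set T) (B : set W) : Prop :=
  exists f : T -> W, set_bij A B f /\ {in A &, {mono f : x y / x <= y}}.

(* Ordinals are given as well-ordered types; in particular a cardinal kappa is
   a type K whose order is that of an initial ordinal. For Y : set K and an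
   ordinal W, [subsets_of_type Y W] is [Y]^W and [subsets_of_type_lt Y W] is
   [Y]^{<W}, the ordinals below W being the order types of its proper initial
   segments. *)
Definition subsets_of_type (d d' : Order.disp_t) (K : orderType d)
    (Y : set K) (W : orderType d') : set (set K) :=
  [set X | X `<=` Y /\ order_isomorphic X [set: W]].

Definition subsets_of_type_lt (d d' : Order.disp_t) (K : orderType d)
    (Y : set K) (W : orderType d') : set (set K) :=
  [set X | X `<=` Y /\ exists w : W, order_isomorphic X (initial_segment w)].

Definition is_cardinal (d : Order.disp_t) (K : orderType d) : Prop :=
  wochoice.well_order (<=%O : rel K) /\
  forall a : K, card_lt (initial_segment a) [set: K].

Definition nonprincipal (T : Type) (U : set_system T) : Prop :=
  ~ exists x : T, U = principal_filter x.

(* K-complete: closed under intersections of fewer than |K| sets *)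
Definition complete_for (K T : Type) (U : set_system T) : Prop :=
  forall F : set (set T), F `<=` U -> card_lt F [set: K] ->
    U (\bigcap_(A in F) A).

Definition measurable_cardinal (d : Order.disp_t) (K : orderType d) : Prop :=
  [/\ is_cardinal K, ~ countable [set: K] &
      exists U : set_system K,
        [/\ UltraFilter U, nonprincipal U & complete_for K U]].

Definition diagonal_intersection (d : Order.disp_t) (K : orderType d)
    (A : K -> set K) : set K :=
  [set a | forall b : K, b < a -> A b a].

Definition normal_ultrafilter (d : Order.disp_t) (K : orderType d)
    (U : set_system K) : Prop :=
  [/\ UltraFilter U, nonprincipal U, complete_for K U &
      forall A : K -> set K, (forall b, U (A b)) ->
        U (diagonal_intersection A)].

Definition pattern (K : Type) (p : set K * set K) : Prop :=
  p.1 `&` p.2 = set0.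

Definition matches (K : Type) (X : set K) (p : set K * set K) : Prop :=
  p.1 `<=` X /\ p.2 `&` X = set0.

(* [A;B], for p = (A, B) *)
Definition matching_sets (d : Order.disp_t) (K : orderType d)
    (p : set K * set K) : set (set K) :=
  [set X | subsets_of_type [set: K] K X /\ matches X p].

(* Sigma(AA, BB), as a set of subsets of [K]^K *)
Definition Sigma (d : Order.disp_t) (K : orderType d)
    (AA BB : set (set K)) : set (set (set K)) :=
  [set S | exists P : set (set K * set K),
     (forall p, P p -> [/\ pattern p, AA p.1 & BB p.2]) /\
     S = \bigcup_(p in P) matching_sets p].

Definition ramsey_witness (d : Order.disp_t) (K : orderType d)
    (S : set (set K)) (H : set K) : Prop :=
  subsets_of_type H K `<=` S \/ subsets_of_type H K `&` S = set0.

(* Main.v *)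
(** The idea: thin out to a set [H] in [U] such that whether a finite subset [s]
    of [H] is the positive part of a pattern of [S] depends only on the size of
    [s] (Rowbottom's theorem), and such that the negative part chosen for [s]
    misses every element of [H] above [s] (a diagonal intersection). If some
    subset of [H] matches a pattern with positive part of size [n], then any
    other [X] in [[H]^K] matches the pattern chosen for the set [s] of the first
    [n] elements of [X]: the elements of [X] outside [s] are all above [s]. *)
Require Import Defs.
From mathcomp Require Import all_boot all_order.
From mathcomp Require Import boolp classical_sets functions cardinality filter.
From mathcomp Require wochoice.

Set Implicit Arguments.
Unset Strict Implicit.
Unset Printing Implicit Defensive.

Import Order.TTheory.

Local Open Scope order_scope.
Local Open Scope classical_set_scope.

Lemma sorted_rcons_rcons (T : Type) (r : rel T) (s : seq T) (x y : T) :
  sorted r (rcons (rcons s x) y) = sorted r (rcons s x) && r x y.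
Proof.
by case: s => [|a s] /=; rewrite ?andbT // rcons_path last_rcons.
Qed.

Section OrderTypes.
Variables (d : Order.disp_t) (K : orderType d).

(** The last clause makes [s] an initial part of [Y] and carries the induction: the least element
    [z] of [Y] outside [s] must lie above all of [s], so appending it keeps the sequence
    increasing. *)
Lemma infinite_initial_seq (wo : wochoice.well_order (<=%O : rel K))
    (Y : set K) (n : nat) :
  infinite_set Y ->
  exists s : seq K, [/\ size s = n, sorted <%O s, [set` s] `<=` Y &
    forall y, Y y -> y \in s \/ sorted <%O (rcons s y)].
Proof.
move=> infY; elim: n => [|n [s [ss so sY sup]]].
  by exists [::]; split=> // y _; right.
have /infinite_setN0 [w [Yw ws]] : infinite_set (Y `\` [set` s]).
  move=> fin; apply: infY.
  apply: (@sub_finite_set _ _ ((Y `\` [set` s]) `|` [set` s])).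
    by move=> y Yy; have [ys|ys] := boolP (y \in s);
      [right | left; split=> //; apply/negP].
  by rewrite finite_setU; split=> //; apply/finite_seqP; exists s.
have [|z [[/asboolP [Yz zs] zmin] _]] :=
  wo (fun y => `[< (Y `\` [set` s]) y >]).
  by exists w; apply/asboolP.
have sz : sorted <%O (rcons s z) by case: (sup z Yz).
exists (rcons s z); split=> //; first by rewrite size_rcons ss.
  by move=> x /=; rewrite mem_rcons inE => /orP [/eqP ->|/sY].
move=> y Yy; rewrite mem_rcons inE sorted_rcons_rcons sz /=.
have [->|yz] := eqVneq y z; first by left.
have [ys|ys] := boolP (y \in s); first by left.
right; rewrite lt_neqAle eq_sym yz /=; apply: zmin.
by apply/asboolP; split=> //; apply/negP.
Qed.

Lemma finite_subset_sorted (A : set K) :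
  subsets_of_type_lt [set: K] nat A ->
  exists2 s : seq K, sorted <%O s & A = [set` s].
Proof.
move=> [_ [w [f [fbij _]]]].
have /finite_seqP [s ->] : finite_set A.
  by exists w; apply/card_set_bijP; exists f.
exists (sort <=%O (undup s)); first by rewrite sort_lt_sorted undup_uniq.
by apply/seteqP; split=> x /=; rewrite mem_sort mem_undup.
Qed.

Lemma subsets_of_type_infinite (Y X : set K) :
  infinite_set [set: K] -> subsets_of_type Y K X -> infinite_set X.
Proof.
move=> infK [_ [f [[_ _ fsurj] _]]] finX; apply: infK.
exact: sub_finite_set fsurj (finite_image f finX).
Qed.

End OrderTypes.

Section NormalUltrafilter.
Variables (d : Order.disp_t) (K : orderType d) (U : set_system K).
Hypothesis hU : normal_ultrafilter U.

Local Instance ultraU : UltraFilter U.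
Proof. by case: hU. Qed.

Let diagU (A : K -> set K) : (forall b, U (A b)) -> U (diagonal_intersection A).
Proof. by case: hU => _ _ _; apply. Qed.

Lemma diagonal_intersection_tail (A : K -> set K) (a : K) (s : seq K) :
  path <%O a s -> [set` s] `<=` diagonal_intersection A ->
  [set` s] `<=` A a.
Proof.
move=> /lt_path_min/allP as_ sA x xs.
exact: sA _ xs _ (as_ _ xs).
Qed.

(** Fixing the least entry [a] leaves a colouring of [n]-element sets, homogeneous on some set in
    [U] by induction. A diagonal intersection serves all [a] at once, since the remaining entries
    lie above [a]. *)
Lemma rowbottom (n : nat) (c : seq K -> Prop) :
  exists H, U H /\ exists v : Prop, forall s, size s = n -> sorted <%O s ->
    [set` s] `<=` H -> (c s <-> v).
Proof.
elim: n c => [|n IHn] c.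
  by exists setT; split; [exact: filterT|exists (c [::]) => -[]].
have /choice [Hv hHv] : forall a, exists Hv : set K * Prop, U Hv.1 /\
    forall s, size s = n -> sorted <%O s -> [set` s] `<=` Hv.1 ->
      (c (a :: s) <-> Hv.2).
  by move=> a; have [H [UH [v hv]]] := IHn (fun s => c (a :: s)); exists (H, v).
have UD : U (diagonal_intersection (fun a => (Hv a).1)).
  by apply: diagU => a; case: (hHv a).
have key (V : set K) (v : Prop) : U V -> (forall a, V a -> ((Hv a).2 <-> v)) ->
    exists H, U H /\ exists v : Prop, forall s, size s = n.+1 ->
      sorted <%O s -> [set` s] `<=` H -> (c s <-> v).
  move=> UV Vv; exists (V `&` diagonal_intersection (fun a => (Hv a).1)).
  split; [exact: filterI|exists v => -[//|a s] [ss] so sH].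
  have [Va _] := sH a (mem_head _ _).
  have [_ ca] := hHv a; rewrite -(Vv _ Va); apply: ca => //.
    exact: path_sorted so.
  apply: (diagonal_intersection_tail (A := fun a => (Hv a).1) so) => x xs.
  by have [] := sH x; rewrite //= inE xs orbT.
(* The homogeneous colour may still depend on [a]; the ultrafilter decides which of the two colours
   occurs for almost all [a]. *)
have [UV|UV] := in_ultra_setVsetC [set a | (Hv a).2] ultraU.
  by apply: (key _ True UV) => a /= va; split.
by apply: (key _ False UV) => a /= va; split.
Qed.

(** Diagonal intersections are iterated [n] times, once for each entry of [s], starting from the
    head. *)
Lemma finite_diagonal_intersection (n : nat) (D : seq K -> set K) :
  (forall s, U (D s)) ->
  exists H, U H /\ forall s x, size s = n -> sorted <%O (rcons s x) ->
    [set` rcons s x] `<=` H -> D s x.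
Proof.
elim: n D => [|n IHn] D UD.
  exists (D [::]); split=> // -[|//] x _ _; apply; exact: mem_head.
have /choice [H hH] : forall a, exists H, U H /\ forall s x, size s = n ->
    sorted <%O (rcons s x) -> [set` rcons s x] `<=` H -> D (a :: s) x.
  by move=> a; apply: IHn.
exists (diagonal_intersection H); split.
  by apply: diagU => a; case: (hH a).
move=> [//|a s] x [ss] so sH; have [_] := hH a; apply=> //.
  exact: path_sorted so.
apply: (diagonal_intersection_tail so) => y ys.
by apply: sH; rewrite /= inE ys orbT.
Qed.

Lemma countable_bigcap (H : nat -> set K) :
  ~ countable [set: K] -> (forall n, U (H n)) -> U (\bigcap_n H n).
Proof.
move=> ncK UH; have [_ _ compl _] := hU.
rewrite -(bigcap_image setT H id); apply: compl; first by move=> _ [n _ <-].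
have cr : countable (H @` setT) by apply: card_image_le.
split; last by move=> le; apply: ncK; apply: sub_countable le cr.
(* The family is countable and [K] is infinite, so the family embeds into [K] through [nat]. *)
apply: card_le_trans cr _; apply/infiniteP => fin.
by apply: ncK; apply: finite_set_countable.
Qed.

End NormalUltrafilter.

Theorem theorem5p1 (d : Order.disp_t) (K : orderType d)
    (hK : measurable_cardinal K)
    (U : set_system K) (hU : normal_ultrafilter U)
    (S : set (set K))
    (hS : Sigma (subsets_of_type_lt [set: K]%classic nat) (~` U)%classic S) :
  exists H : set K, U H /\ ramsey_witness S H.
Proof.
have [[wo _] ncK _] := hK; have [ultraU _ _ _] := hU.
have infK : infinite_set [set: K] by move=> /finite_set_countable.
have [P [hP ->]] := hS.
pose c (s : seq K) := exists B, P ([set` s], B).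
(* [D s] is the complement of a negative part chosen for [s], hence in [U]; it defaults to [setT]
   when [s] is not a positive part. *)
have /choice [D hD] : forall s, exists D, U D /\ (c s -> P ([set` s], ~` D)).
  move=> s; have [[B PB]|ncs] := pselect (c s).
    exists (~` B); rewrite setCK; split=> //; have [_ _ nUB] := hP _ PB.
    by case: (in_ultra_setVsetC B ultraU).
  by exists setT; split=> //; exact: filterT.
have /choice [R hR] := fun n => rowbottom hU n c.
have UD s : U (D s) by case: (hD s).
have /choice [E hE] := fun n => finite_diagonal_intersection hU n UD.
(* The size of the positive part is not known in advance, so [H] must serve all finite sizes at
   once. *)
pose H := \bigcap_n (R n `&` E n).
have HR n : H `<=` R n by move=> x /(_ n I) [].
have HE n : H `<=` E n by move=> x /(_ n I) [].
exists H; split.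
  apply: countable_bigcap => // n; apply: filterI; first by case: (hR n).
  by case: (hE n).
have [[X0 [X0H [p Pp [_ [pX0 _]]]]]|none] :=
  pselect (exists X, subsets_of_type H K X /\
                     (\bigcup_(p in P) matching_sets p) X); last first.
  by right; apply/seteqP; split=> // X [XH XS]; apply: none; exists X.
left=> X XH; have [fp _ _] := hP _ Pp; have [_ fin_p _] := hP _ Pp.
have [s0 so0 ps0] := finite_subset_sorted fin_p.
have [_ [v hv]] := hR (size s0).
have c0 : c s0 by exists p.2; rewrite -ps0 -surjective_pairing.
(* The positive part [s0] lies in [X0], hence in [H], so the colour of its size is the positive
   one. *)
have vT : v.
  rewrite -(hv s0) // -ps0 => x px; apply: HR; case: X0H => + _; apply.
  exact: pX0.
have [s [ss so sX sup]] :=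
  infinite_initial_seq wo (size s0) (subsets_of_type_infinite infK XH).
have sH : [set` s] `<=` H by move=> x /sX; case: XH => + _; apply.
have Ps : P ([set` s], ~` D s).
  by apply: (hD s).2; rewrite (hv s ss so) // => x /sH; apply: HR.
exists ([set` s], ~` D s) => //; split; first by case: XH.
split=> //; apply/seteqP; split=> // y [nDy Xy].
(* An element of [X] in the negative part is impossible: inside [s] it contradicts disjointness of
   the pattern, and above [s] it lies in [D s]. *)
have [ys|sy] := sup y Xy.
  by have [pat _ _] := hP _ Ps; rewrite -pat.
apply: nDy; have [_] := hE (size s0); apply=> // x /=.
rewrite mem_rcons inE => /orP [/eqP ->|/sH]; last exact: HE.
by apply: HE; case: XH => + _; apply.
Qed.
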